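(* There is an absolute constant $C>0$ such that the following holds. Let $N,n\in\mathbb N$ and $\epsilon>0$, and let $\Psi$ be the set of $n$-block strings in $\{0,1\}^N$. There is a retention rate $\rho\in(0,1)$ with $\rho N\le C n/\epsilon$ and a $(\Psi,\mathrm{far}^{\mathrm{rel\text{-}edit}}_\epsilon(\Psi),\rho,2/3)$-trace tester using one trace.
   Context: For $x\in\{0,1\}^N$ and $\rho\in(0,1)$, a trace of $x$ with retention rate $\rho$ is the random subsequence obtained by deleting each character of $x$ independently with probability $1-\rho$ (its expected length is $\rho N$). For sets $\Psi_1,\Psi_2\subseteq\{0,1\}^N$, a $(\Psi_1,\Psi_2,\rho,\alpha)$-trace tester using $k$ traces is an algorithm that receives $k$ independent traces of the unknown $x$ with retention rate $\rho$, accepts with probability $\ge\alpha$ if $x\in\Psi_1$ and rejects with probability $\ge\alpha$ if $x\in\Psi_2$. A block is a maximal run of equal symbols; $x$ is an $n$-block string if it consists of at most $n$ blocks. $d_{\mathrm{rel\text{-}edit}}(x,y)=\frac{2}{N+M}\mathrm{ed}(x,y)$ for $x\in\{0,1\}^N,y\in\{0,1\}^M$, with $\mathrm{ed}$ the standard (insertion/deletion/substitution) edit distance; $\mathrm{far}^{\mathrm{rel\text{-}edit}}_\epsilon(\Psi)$ is the set of $x\in\{0,1\}^N$ with $\min_{y\in\Psi}d_{\mathrm{rel\text{-}edit}}(x,y)>\epsilon$. *)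

(* Defs.v *)
From mathcomp Require Import all_boot all_order all_algebra.
From mathcomp Require Import boolp reals constructive_ereal.

Set Implicit Arguments.
Unset Strict Implicit.
Unset Printing Implicit Defensive.

Import Order.TTheory GRing.Theory Num.Theory.
Local Open Scope ring_scope.

Section Blocks.
Local Open Scope nat_scope.
Variable T : eqType.

(* The interval (i, j) denotes the positions i, i + 1, ..., j - 1 of x. *)
Definition is_run (x : seq T) (i j : nat) : bool :=
  [&& i < j, j <= size x & constant (take (j - i) (drop i x))].

Definition blocks (x : seq T) : {set 'I_(size x).+1 * 'I_(size x).+1} :=
  [set p : 'I_(size x).+1 * 'I_(size x).+1 | is_run x p.1 p.2 &
    [forall q : 'I_(size x).+1 * 'I_(size x).+1,
      [&& q.1 <= p.1, p.2 <= q.2 & is_run x q.1 q.2] ==> (q == p)]].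

Definition nblocks (x : seq T) : nat := #|blocks x|.

End Blocks.

Definition block_strings (N n : nat) : {set N.-tuple bool} :=
  [set x : N.-tuple bool | (nblocks x <= n)%N].

Section EditDistance.
Variable T : Type.
Implicit Types s t u v : seq T.

Inductive edit_step : seq T -> seq T -> Prop :=
| edit_ins u v a : edit_step (u ++ v) (u ++ a :: v)
| edit_del u v a : edit_step (u ++ a :: v) (u ++ v)
| edit_sub u v a b : edit_step (u ++ a :: v) (u ++ b :: v).

Inductive edits : nat -> seq T -> seq T -> Prop :=
| edits0 s : edits 0 s s
| editsS k s t u : edit_step s t -> edits k t u -> edits k.+1 s u.

Lemma edits_exists s t : exists k, `[< edits k s t >].
Proof.
elim: s => [|a s [k /asboolP IHs]]; last first.
  exists k.+1; apply/asboolP; apply: editsS IHs.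
  exact: (edit_del [::] s a).
suff H u : edits (size t) u (u ++ t).
  by exists (size t); apply/asboolP; exact: (H [::]).
elim: t u => [|a t IHt] u; first by rewrite cats0; exact: edits0.
apply: (@editsS _ u (rcons u a)); last by rewrite -cat_rcons; exact: IHt.
by rewrite -cats1 -{1}[u]cats0; exact: edit_ins.
Qed.

Definition edit_dist s t : nat := ex_minn (edits_exists s t).

End EditDistance.

Definition rel_edit_dist (R : realType) (x y : seq bool) : R :=
  2 / (size x + size y)%:R * (edit_dist x y)%:R.

(* The minimum is taken in \bar R, so that over the empty set it is +oo. *)
Definition far_rel_edit (R : realType) (N : nat) (eps : R)
    (Psi : {set N.-tuple bool}) : {set N.-tuple bool} :=
  [set x : N.-tuple bool |
    (eps%:E < \big[Order.min/+oo]_(y in Psi) (rel_edit_dist R x y)%:E)%E].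

Section Traces.
Variables (R : realType) (N : nat).

(* A deletion pattern m keeps position i iff tnth m i = true; the resulting
   trace of x is mask m x. *)
Definition pattern_prob (rho : R) (m : N.-tuple bool) : R :=
  \prod_(i < N) (if tnth m i then rho else 1 - rho).

(* Expectation of f over k independent traces of x with retention rate rho. *)
Definition traces_expectation (rho : R) (x : N.-tuple bool) (k : nat)
    (f : k.-tuple (seq bool) -> R) : R :=
  \sum_(ms : k.-tuple (N.-tuple bool))
    (\prod_(j < k) pattern_prob rho (tnth ms j)) *
    f (map_tuple (fun m : N.-tuple bool => mask m x) ms).

(* A (possibly randomized) algorithm is represented by the probability A t,
   over its internal randomness, that it accepts on input t. *)
Definition is_trace_tester (Psi1 Psi2 : {set N.-tuple bool}) (rho alpha : R)
    (k : nat) (A : k.-tuple (seq bool) -> R) : Prop :=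
  [/\ forall t, 0 <= A t <= 1,
      forall x, x \in Psi1 -> alpha <= traces_expectation rho x A
    & forall x, x \in Psi2 ->
        alpha <= traces_expectation rho x (fun t => 1 - A t)].

End Traces.

(* Main.v *)
(** The tester accepts iff the trace has at most [n] blocks; since blocks do not
    increase under deletion, strings in [Psi] are always accepted. For a far [x],
    read [x] from left to right, letting the current symbol be the last retained
    one. Whenever [x] disagrees with the current symbol, the disagreeing
    character is retained with probability [rho], opening a new block of the
    trace; hence about [1 / rho] disagreements are seen per block. If the trace
    has at most [n] blocks, filling deleted positions with the current symbol
    gives an [n]-block string at Hamming distance more than [eps * N] from [x],
    which by the optional-stopping count has probability at most
    [(n + 1) / (rho * eps * N)], that is at most [1 / 3] for
    [rho = 6 n / (eps N)]. When this value is at least [1], take instead [rho]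
    so close to [1] that the trace is all of [x] with probability [2 / 3]. *)
Require Import Defs.
From mathcomp Require Import all_boot all_order all_algebra.
From mathcomp Require Import boolp reals constructive_ereal.
From mathcomp Require Import zify ring lra.
Import Order.TTheory GRing.Theory Num.Theory.
Local Open Scope ring_scope.

Set Implicit Arguments.
Unset Strict Implicit.
Unset Printing Implicit Defensive.

(** * Blocks counted as symbol changes; Hamming distance *)

Section Changes.
Local Open Scope nat_scope.
Variable T : eqType.
Implicit Types (o : option T) (s t x : seq T).

(* [o] is the symbol preceding [s], if any; with [o = None] the first symbol of
   [s] counts as a change, so that [changes None s] is the number of blocks. *)
Fixpoint changes o s : nat :=
  if s is a :: s' then (o != Some a) + changes (Some a) s' else 0.

(** If [o] differs from the head of [s], then a change occurs on entering or on leaving the [a] put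
    between them. *)
Lemma changes_cons_le o a s : changes o s <= changes o (a :: s).
Proof.
case: s => [|b s] //=; case: (o =P Some a) => [-> //|_].
by rewrite addnA leq_add2r; case: (_ != _) => //; exact: leq_addr.
Qed.

Lemma changes_subseq o s t : subseq t s -> changes o t <= changes o s.
Proof.
elim: s t o => [|a s IHs] [|b t] o //=.
case: eqP => [->|_] h; first by rewrite leq_add2l IHs.
exact: leq_trans (IHs _ o h) (changes_cons_le o a s).
Qed.

Lemma changes_sum o s :
  changes o s =
  \sum_(i < size s) (nth None (o :: map Some s) i != onth s i).
Proof.
elim: s o => [|a s IHs] o /=; first by rewrite big_ord0.
by rewrite big_ord_recl /= IHs.
Qed.

Lemma constant_onthP s :
  reflect (forall k, k < size s -> onth s k = onth s 0) (constant s).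
Proof.
case: s => [|a s]; first by constructor.
apply: (iffP allP) => [h [|k] //=|h y /onthP[i si]].
  rewrite ltnS -onthTE; case sk: (onth s k) => [b|//] _.
  by congr Some; apply/eqP/h/onthP; exists k.
by have := h i.+1; rewrite /= ltnS -onthTE si => /(_ isT)[->] /=.
Qed.

Lemma is_runP x i j :
  reflect [/\ i < j, j <= size x &
             forall k, i <= k < j -> onth x k = onth x i] (is_run x i j).
Proof.
have onE l : l < j - i -> onth (take (j - i) (drop i x)) l = onth x (i + l).
  by move=> lt; rewrite !onthE map_take map_drop nth_take // nth_drop.
have szE : j <= size x -> size (take (j - i) (drop i x)) = j - i.
  by move=> jx; rewrite size_takel // size_drop leq_sub2r.
apply: (iffP and3P) => -[ij jx h]; split=> //.
  move/constant_onthP: h => h k /andP[ik kj].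
  have := h (k - i); rewrite szE // !onE ?subnKC ?addn0; try lia.
  by apply; lia.
apply/constant_onthP => k; rewrite szE // => kij.
by rewrite !onE ?addn0; [apply: h; lia | lia | lia].
Qed.

(** Runs with a common left end are nested, so maximality identifies them. Blocks can thus be
    counted by their left ends. *)
Lemma blocks_fst_inj x : {in blocks x &, injective (fun p => p.1)}.
Proof.
move=> [i j] [i' j']; rewrite !inE /=.
move=> /andP[rp /forallP mp] /andP[rq /forallP mq].
move=> eqi; rewrite -{}eqi in rq mq *.
case: (leqP j j') => [le|/ltnW le].
  by have := mp (i, j'); rewrite /= leqnn le rq => /eqP.
by have := mq (i, j); rewrite /= leqnn le rp => /eqP.
Qed.

(** A run whose first symbol repeats its predecessor extends to the left; conversely, the longest
    run starting at a change is maximal. *)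
Lemma blocks_fst x :
  [set p.1 | p in blocks x] =
  [set i : 'I_(size x).+1 | (i < size x) &&
     (nth None (None :: map Some x) i != onth x i)].
Proof.
apply/setP => i; rewrite inE; apply/imsetP/andP.
  case=> -[i' j]; rewrite inE /= => /andP[rp /forallP mp] ->{i}.
  have /is_runP[ij jx h] := rp.
  split; first exact: leq_trans ij jx.
  apply/eqP; case: i' => -[|i] hi in rp mp ij h *.
    move=> e; have := onthTE x 0; rewrite (esym e : onth x 0 = None).
    by rewrite (leq_ltn_trans _ (leq_trans ij jx)).
  move=> /=; rewrite -onthE /= => e.
  have hi' : i < (size x).+1 by exact: ltnW.
  have := mp (Ordinal hi', j); rewrite /= leqnSn leqnn /=.
  suff -> : is_run x i j.
    by move=> /eqP[] /eqP; rewrite -[_ == _]/(i == i.+1); lia.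
  apply/is_runP; split=> //; first by exact: ltnW.
  move=> k /andP[ik kj]; rewrite e.
  move: ik; rewrite leq_eqVlt => /orP[/eqP<- //|ik].
  by apply: h; rewrite /= ik kj.
move=> [ix sti].
pose P j := is_run x i j.
have exP : exists j, P j.
  exists i.+1; apply/is_runP; split=> // k; rewrite ltnS => ik.
  by congr onth; apply/eqP; rewrite eqn_leq andbC.
have bdP j : P j -> j <= size x by case/is_runP.
have [j Pj maxj] := ex_maxnP exP bdP.
have /is_runP[ij _ _] := Pj.
have jx : j < (size x).+1 by rewrite ltnS bdP.
exists (i, Ordinal jx); rewrite // inE /=; apply/andP; split; first exact: Pj.
apply/forallP => -[i' j'] /=; apply/implyP => /and3P[le_i le_j r'].
have /is_runP[ij' j'x h'] := r'.
have ei : i' = i.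
  apply/val_inj/eqP; rewrite /= eqn_leq le_i leqNgt; apply: contraNN sti => lt_i.
  case: i {exP bdP Pj maxj P} => -[|i] //= hi in ij ix le_i lt_i *.
  rewrite -onthE; apply/eqP.
  by transitivity (onth x i'); [apply: h' | apply/esym/(h' i.+1)]; lia.
rewrite ei in r' *; apply/eqP; congr (_, _); apply/val_inj/eqP.
by rewrite /= eqn_leq le_j (maxj j').
Qed.

Lemma nblocksE x : nblocks x = changes None x.
Proof.
rewrite changes_sum /nblocks -(card_in_imset (@blocks_fst_inj x)) blocks_fst.
rewrite -sum1dep_card big_mkcond big_ord_recr /= ltnn /= addn0.
by apply: eq_bigr => i _; rewrite ltn_ord /=; case: (_ != _).
Qed.

(* Meaningful only for strings of equal length: the excess is ignored. *)
Fixpoint hamming s t : nat :=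
  match s, t with
  | a :: s', b :: t' => (a != b) + hamming s' t'
  | _, _ => 0
  end.

Lemma hammingxx s : hamming s s = 0.
Proof. by elim: s => //= a s ->; rewrite eqxx. Qed.

Lemma edits_hamming s t u :
  size s = size t -> edits (hamming s t) (u ++ s) (u ++ t).
Proof.
elim: s t u => [|a s IHs] [|b t] u //=; first by move=> _; exact: edits0.
move=> [/(IHs t (rcons u b))]; rewrite !cat_rcons => e.
case: eqP => [->//|_]; exact: editsS (edit_sub _ _ _ _) e.
Qed.

Lemma edit_dist_hamming s t :
  size s = size t -> edit_dist s t <= hamming s t.
Proof.
move=> st; rewrite /edit_dist; case: ex_minnP => d _; apply.
by apply/asboolP; exact: (edits_hamming [::]).
Qed.

End Changes.

(** * Expectation over a single trace *)

Section TraceMean.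
Variables (R : realType) (T : eqType) (rho : R).
Implicit Types (s : seq T) (f g : seq T -> R).

(* The expectation of [f] over one trace of [s], by conditioning on whether the
   first character is retained. *)
Fixpoint trace_mean s f : R :=
  if s is a :: s' then
    rho * trace_mean s' (fun t => f (a :: t)) + (1 - rho) * trace_mean s' f
  else f [::].

Lemma eq_trace_mean s f g :
  (forall t, subseq t s -> f t = g t) -> trace_mean s f = trace_mean s g.
Proof.
elim: s f g => [|a s IHs] f g fg; first exact: fg.
congr (_ * _ + _ * _); apply: IHs => t ts; apply: fg; first by rewrite /= eqxx.
exact: subseq_trans ts (subseq_cons s a).
Qed.

Lemma trace_mean_cst s c : trace_mean s (fun=> c) = c.
Proof. by elim: s => //= a s ->; ring. Qed.

Lemma trace_meanC s f : trace_mean s (fun t => 1 - f t) = 1 - trace_mean s f.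
Proof. by elim: s f => //= a s IHs f; rewrite !IHs; ring. Qed.

Lemma sum_pattern_prob N (x : N.-tuple T) f :
  \sum_(m : N.-tuple bool) pattern_prob rho m * f (mask m x) = trace_mean x f.
Proof.
elim: N x f => [|N IHN] x f.
  rewrite (big_pred1 [tuple]) => [|m]; last first.
    by apply/esym/eqP/val_inj/size0nil; rewrite size_tuple.
  by rewrite /pattern_prob big_ord0 mul1r (tuple0 x).
case/tupleP: x => a x /=; rewrite -!IHN !mulr_sumr.
rewrite (reindex (fun p : bool * N.-tuple bool =>
  cons_tuple p.1 p.2)) /=; last first.
  exists (fun m => (thead m, [tuple of behead m])) => [[b m] _|m _].
    by rewrite theadE; congr (_, _); apply/val_inj.
  by rewrite [RHS]tuple_eta.
rewrite -(pair_bigA _ (fun b m => pattern_prob rho (cons_tuple b m) *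
   f (mask (cons_tuple b m) (a :: x)))) /= big_bool /=.
have cons_prob b (m : N.-tuple bool) :
    pattern_prob rho (cons_tuple b m) =
    (if b then rho else 1 - rho) * pattern_prob rho m.
  rewrite /pattern_prob big_ord_recl tnth0; congr (_ * _).
  by apply: eq_bigr => i _; rewrite tnthS.
by congr (_ + _); apply: eq_bigr => m _; rewrite cons_prob mulrA.
Qed.

Hypotheses (rho0 : 0 <= rho) (rho1 : rho <= 1).

Lemma ler_trace_mean s f g :
  (forall t, f t <= g t) -> trace_mean s f <= trace_mean s g.
Proof.
elim: s f g => [|a s IHs] f g fg //=.
by rewrite lerD // ler_wpM2l ?subr_ge0 ?IHs.
Qed.

(** Only the outcome in which nothing is deleted is kept. *)
Lemma trace_mean_ge_full s f :
  (forall t, 0 <= f t) -> rho ^+ size s * f s <= trace_mean s f.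
Proof.
elim: s f => [|a s IHs] f f0 /=; first by rewrite mul1r.
rewrite exprS -mulrA -[leLHS]addr0 lerD //.
  by rewrite ler_wpM2l //; exact: IHs (fun t => f (a :: t)) _.
by rewrite mulr_ge0 ?subr_ge0 // -(trace_mean_cst s 0) ler_trace_mean.
Qed.

End TraceMean.

Lemma traces_expectation1 (R : realType) (N : nat) (rho : R) (x : N.-tuple bool)
    (A : 1.-tuple (seq bool) -> R) :
  traces_expectation rho x A = trace_mean rho x (fun t => A [tuple t]).
Proof.
rewrite -sum_pattern_prob /traces_expectation.
rewrite (reindex (fun m : N.-tuple bool => [tuple m])) /=; last first.
  exists (@thead _ _) => [m _|m _]; first exact: theadE.
  by rewrite [RHS]tuple_eta; apply/val_inj; case: m => [[|? []]].
by apply: eq_bigr => m _; rewrite big_ord1; congr (_ * A _); apply/val_inj.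
Qed.

(** * Probability that a trace has few blocks *)

Section FewChanges.
Variables (R : realType) (T : eqType) (rho : R).
Hypotheses (rho0 : 0 <= rho) (rho1 : rho <= 1).
Implicit Types (o : option T) (s z : seq T).

Definition prob_changes_lt o s k : R :=
  trace_mean rho s (fun t => (changes o t < k)%N%:R).

Lemma prob_changes_lt_le1 o s k : prob_changes_lt o s k <= 1.
Proof.
rewrite -[leRHS](trace_mean_cst rho s 1); apply: ler_trace_mean => // t.
by case: (_ < _)%N.
Qed.

Lemma prob_changes_lt_eq1 o s k :
  (changes o s < k)%N -> prob_changes_lt o s k = 1.
Proof.
move=> sk; rewrite -[RHS](trace_mean_cst rho s 1).
apply: eq_trace_mean => t /changes_subseq ts.
by rewrite (leq_ltn_trans (ts o) sk).
Qed.

Lemma prob_changes_lt0 o s : prob_changes_lt o s 0 = 0.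
Proof. by rewrite -[RHS](trace_mean_cst rho s 0); exact: eq_trace_mean. Qed.

Lemma prob_changes_lt_cons_eq a s k :
  prob_changes_lt (Some a) (a :: s) k = prob_changes_lt (Some a) s k.
Proof.
rewrite /prob_changes_lt /= eqxx /= -mulrDl [X in X * _](_ : _ = 1) ?mul1r //.
ring.
Qed.

Lemma prob_changes_lt_cons_neq o a s k : o != Some a ->
  prob_changes_lt o (a :: s) k.+1 =
  rho * prob_changes_lt (Some a) s k + (1 - rho) * prob_changes_lt o s k.+1.
Proof. by move=> oa; rewrite /prob_changes_lt /= oa. Qed.

(* The hypothesis says that [s] is [d]-far from all strings with fewer than [k]
   changes; it is what the induction needs to hold of the suffixes of [s]. For
   [o = None], even an empty trace yields a nonempty string with one change,
   whence [1 < k]. *)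
Lemma prob_changes_lt_bound o s k (d : R) :
  (o = None -> 1 < k)%N ->
  (forall z, size z = size s -> (changes o z < k)%N ->
     d <= (hamming s z)%:R) ->
  d * rho * prob_changes_lt o s k <= k%:R.
Proof.
elim: s o k d => [|a s IHs] o [|k] d ok ham; rewrite ?prob_changes_lt0 ?mulr0 //.
  have d0 : d <= 0 by exact: (ham [::]).
  by rewrite /prob_changes_lt /= mulr1 (le_trans _ (ler0n _ _)) // mulr_le0_ge0.
have [oa|oa] := eqVneq o (Some a).
  rewrite oa prob_changes_lt_cons_eq; apply: IHs => // z sz cz.
  by have := ham (a :: z); rewrite /= oa !eqxx sz; apply.
rewrite prob_changes_lt_cons_neq //.
set p := prob_changes_lt (Some a) s k; set q := prob_changes_lt o s k.+1.
(* Case [a] retained: prefixing [a] to [z] uses one change and adds no mismatch, so [d] is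
   preserved. *)
have IHp : d * rho * p <= k%:R.
  apply: IHs => // z sz cz.
  by have := ham (a :: z); rewrite /= oa eqxx sz; apply.
(* Case [a] deleted: the symbol filled in may mismatch [a], so [d] drops by one. *)
have IHq : (d - 1) * rho * q <= k.+1%:R.
  apply: IHs => // z sz cz.
  (* Prepending the current symbol costs no change. *)
  have [c cc] : exists c, (changes o (c :: z) < k.+1)%N.
    case: o z ok {ham oa q sz} cz => [b|] [|c z] ok cz.
    - by exists b; rewrite /= eqxx.
    - by exists b; rewrite /= eqxx.
    - by exists a; rewrite /= ok.
    - by exists c; rewrite /= eqxx.
  rewrite lerBlDl (le_trans (ham (c :: z) _ cc)) /= ?sz //.
  by rewrite natrD lerD2r; case: (_ != _).
(* Averaging the two bounds with weights [rho] and [1 - rho] gives [k + 1 - rho]; restoring the lost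
   mismatch adds [rho * (1 - rho) * q], which is at most [rho]. *)
have q1 : q <= 1 by exact: prob_changes_lt_le1.
rewrite -natr1 in IHq *.
have IHp' := ler_wpM2l rho0 IHp.
have rho1' : 0 <= 1 - rho by rewrite subr_ge0.
have IHq' := ler_wpM2l rho1' IHq.
have q1' := ler_wpM2l (mulr_ge0 rho0 rho1') q1.
nra.
Qed.

End FewChanges.

(** * Far strings and the tester *)

Lemma bernoulli_inequality (R : realDomainType) (a : R) N :
  0 <= a <= 1 -> 1 - N%:R * a <= (1 - a) ^+ N.
Proof.
move=> /andP[a0 a1]; elim: N => [|N IHN]; first by rewrite mul0r subr0.
have b0 : 0 <= 1 - a by rewrite subr_ge0.
have N0 : 0 <= N%:R :> R by [].
have := ler_wpM2l b0 IHN; have := mulr_ge0 N0 (mulr_ge0 a0 a0).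
rewrite exprS -natr1; nra.
Qed.

Lemma far_rel_edit_hamming (R : realType) (N : nat) (eps : R)
    (Psi : {set N.-tuple bool}) (x y : N.-tuple bool) : 0 < eps ->
  x \in far_rel_edit eps Psi -> y \in Psi ->
  eps * N%:R <= (hamming x y)%:R /\ y != x.
Proof.
move=> eps0; rewrite inE => xfar yPsi.
have := lt_le_trans xfar
  (bigmin_le_cond +oo%E
     (fun z : N.-tuple bool => (rel_edit_dist R x z)%:E) yPsi).
rewrite lte_fin /rel_edit_dist !size_tuple => d_gt.
have ed_le : (edit_dist x y)%:R <= (hamming x y)%:R :> R.
  by rewrite ler_nat edit_dist_hamming ?size_tuple.
(* For [N = 0] the relative distance is [0], since the inverse of zero is zero, so no string is
   far. *)
have [N0|N0] := posnP N.
  by move: d_gt; rewrite {1 2}N0 invr0 mulr0 mul0r ltNge ltW.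
split.
  rewrite (le_trans _ ed_le) //; move: d_gt.
  have -> : 2 / (N + N)%:R = N%:R^-1 :> R.
    by rewrite natrD; field; rewrite -natrD !pnatr_eq0; lia.
  by move/ltW; rewrite mulrC ler_pdivlMr ?ltr0n.
apply: contraTneq d_gt => yx; rewrite yx in ed_le *.
move: ed_le; rewrite hammingxx ler_nat leqn0 => /eqP->.
by rewrite mulr0 ltNge ltW.
Qed.

Theorem theorem7p13 (R : realType) :
  exists C : R, 0 < C /\
    forall (N n : nat) (eps : R), (0 < n)%N -> 0 < eps ->
      exists rho : R,
        [/\ 0 < rho, rho < 1, rho * N%:R <= C * n%:R / eps
          & exists A : 1.-tuple (seq bool) -> R,
              is_trace_tester (block_strings N n)
                (far_rel_edit eps (block_strings N n)) rho (2 / 3) A].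
Proof.
(* With [6], the error is at most [(n + 1) / (6 * n)], which is at most [1 / 3] as [n] is at least
   [1]. *)
exists 6; split=> // N n eps n0 eps0.
suff [rho [rho0 rho1 rhoN H]] : exists rho : R,
    [/\ 0 < rho, rho < 1, rho * N%:R <= 6 * n%:R / eps
      & forall x, x \in far_rel_edit eps (block_strings N n) ->
          prob_changes_lt rho None x n.+1 <= 1 / 3].
  exists rho; split=> //.
  pose A (t : 1.-tuple (seq bool)) : R := (nblocks (thead t) <= n)%N%:R.
  have EA (x : N.-tuple bool) :
      traces_expectation rho x A = prob_changes_lt rho None x n.+1.
    rewrite traces_expectation1; apply: eq_trace_mean => t _.
    by rewrite /A theadE nblocksE.
  exists A; split.
  - by move=> t; rewrite /A; case: (_ <= _)%N; rewrite ?lexx ler01.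
  - by move=> x; rewrite inE EA nblocksE => xn; rewrite prob_changes_lt_eq1 //; lra.
  - move=> x /H; rewrite traces_expectation1 trace_meanC.
    by rewrite -traces_expectation1 EA; lra.
have nR : 1 <= n%:R :> R by rewrite ler1n.
have [|big] := ltP (6 * n%:R) (eps * N%:R); last first.
  (* By Bernoulli, all [N] characters survive with probability at least [1 - N * a]; [N.+1] keeps
     [a] positive when [N = 0]. *)
  pose a : R := (3 * N.+1%:R)^-1.
  have a0 : 0 < a by rewrite invr_gt0 mulr_gt0.
  have Na : N%:R * a <= 1 / 3.
    by rewrite /a ler_pdivrMr ?mulr_gt0 // -(natr1 N); lra.
  have a1 : a < 1.
    by rewrite /a invf_lt1 ?mulr_gt0 // -natrM ltr1n; lia.
  have rho0 : 0 < 1 - a by rewrite subr_gt0.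
  exists (1 - a); split=> //; first by rewrite gtrBl.
    rewrite ler_pdivlMr // mulrC (le_trans _ big) // ler_wpM2l ?(ltW eps0) //.
    by rewrite ler_piMl // gerBl ltW.
  move=> x xfar.
  have xn : (changes None x < n.+1)%N = false.
    apply/negP => xn.
    have xPsi : x \in block_strings N n by rewrite inE nblocksE.
    by have [_] := far_rel_edit_hamming eps0 xfar xPsi; rewrite eqxx.
  have rho1 : 1 - a <= 1 by rewrite gerBl ltW.
  have := @trace_mean_ge_full R bool _ (ltW rho0) rho1 x
    (fun t => 1 - (changes None t < n.+1)%N%:R).
  rewrite xn subr0 mulr1 trace_meanC size_tuple => full.
  have {}full : (1 - a) ^+ N <= 1 - prob_changes_lt (1 - a) None x n.+1.
    by apply: full => t; case: (_ < _)%N; rewrite ?subrr ?subr0.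
  have := @bernoulli_inequality R a N; rewrite (ltW a0) (ltW a1) => /(_ isT).
  lra.
move=> small.
have NR : 0 < eps * N%:R by rewrite (lt_trans _ small) // mulr_gt0 //; lra.
have NR0 : N%:R != 0 :> R by apply: contraTneq NR => ->; rewrite mulr0 ltxx.
have rho1 : 6 * n%:R / (eps * N%:R) < 1 by rewrite ltr_pdivrMr // mul1r.
have rho0 : 0 < 6 * n%:R / (eps * N%:R) by rewrite divr_gt0 //; lra.
exists (6 * n%:R / (eps * N%:R)); split=> //.
  by rewrite le_eqVlt; apply/orP; left; apply/eqP; field; rewrite NR0 gt_eqF.
move=> x xfar.
have := @prob_changes_lt_bound R bool _ (ltW rho0) (ltW rho1)
  None x n.+1 (eps * N%:R).
rewrite mulrCA divff ?gt_eqF // mulr1 -(natr1 n) => bound.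
set p := prob_changes_lt _ _ _ _ in bound *.
suff p6n : 6 * n%:R * p <= n%:R + 1.
  have n2 : 0 < 2 * n%:R :> R by lra.
  by rewrite ler_pdivlMr // -(ler_pM2l n2); lra.
(* The side condition [1 < n.+1] for [o = None] comes from [n0]. *)
apply: bound => // z sz cz.
have zN : size z == N by rewrite sz size_tuple.
have zPsi : Tuple zN \in block_strings N n by rewrite inE nblocksE.
by have [] := far_rel_edit_hamming eps0 xfar zPsi.
Qed.
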